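(* Let $\mathcal{I}$ be a set and let $\{f_i\colon \mathcal{T}\to \mathcal{T}_i\}_{i\in\mathcal{I}}$ be a family of coproduct-preserving tt-functors between tt-categories with small coproducts. Assume that each $f_i$ has a coproduct-preserving adjoint $g_i\colon \mathcal{T}_i\to\mathcal{T}$ (either a left adjoint or a right adjoint) satisfying the projection formula $$g_i(f_i(x)\otimes y)\cong x\otimes g_i(y)\qquad\text{for all } x\in \mathcal{T},\ y\in \mathcal{T}_i .$$ If $\mathbb{1}_{\mathcal{T}}\in \mathrm{Loc}^\otimes\left(\coprod_{i\in \mathcal{I}}g_{i}(\mathbb{1}_{\mathcal{T}_i})\right)$, then for any objects $x$ and $y$ of $\mathcal{T}$ the following hold. (1) (Detection) If $f_i(x)=0$ for each $i\in \mathcal{I}$, then $x=0$. (2) (Building) $x\in \mathrm{Loc}^\otimes (y)$ if and only if $f_i(x)\in \mathrm{Loc}^\otimes(f_i(y))$ for all $i\in \mathcal{I}$.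
   Context: A tt-category is a tensor-triangulated category: a triangulated category with a symmetric monoidal structure $\otimes$ (unit $\mathbb{1}$) that is exact in each variable. All tt-categories with small coproducts considered here are such that $\otimes$ commutes with coproducts in each variable separately. A tt-functor is a strongly monoidal triangulated functor. A localizing subcategory is a full triangulated subcategory closed under small coproducts; it is a localizing tensor-ideal if it is moreover closed under tensoring with arbitrary objects. $\mathrm{Loc}^\otimes(\mathcal{X})$ denotes the smallest localizing tensor-ideal containing the object or collection of objects $\mathcal{X}$. *)

(* Defs.v *)
From mathcomp Require Import all_boot all_algebra.
From mathcomp Require Import boolp classical_sets.
Set Implicit Arguments.
Unset Strict Implicit.
Unset Printing Implicit Defensive.
Import GRing.Theory.
Local Open Scope ring_scope.

Declare Scope cat_scope.
Delimit Scope cat_scope with cat.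
Local Open Scope cat_scope.

(* A single universe for the index types of small families.  Objects of a     *)
(* category live in an unrelated (possibly larger) universe.                  *)
Definition smallType := Type.

(* Every category occurring here is preadditive, so the hom-groups are part   *)
(* of the basic structure.  [functor] below is nevertheless a plain functor;  *)
(* additivity is the separate predicate [additive_functor].                   *)
Record preadditive_cat := PreadditiveCat {
  obj :> Type;
  hom : obj -> obj -> zmodType;
  idm : forall X, hom X X;
  ccomp : forall X Y Z, hom Y Z -> hom X Y -> hom X Z;
  ccomp1m : forall X Y (f : hom X Y), ccomp (idm Y) f = f;
  ccompm1 : forall X Y (f : hom X Y), ccomp f (idm X) = f;
  ccompA : forall W X Y Z (h : hom Y Z) (g : hom X Y) (f : hom W X),
    ccomp h (ccomp g f) = ccomp (ccomp h g) f;
  ccompDl : forall X Y Z (g g' : hom Y Z) (f : hom X Y),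
    ccomp (g + g') f = ccomp g f + ccomp g' f;
  ccompDr : forall X Y Z (g : hom Y Z) (f f' : hom X Y),
    ccomp g (f + f') = ccomp g f + ccomp g f'
}.

Arguments hom {_} X Y.
Arguments idm {_} X.
Arguments ccomp {_ X Y Z} g f.

Notation "g ∘ f" := (ccomp g f) (at level 40, left associativity) : cat_scope.

Section Basics.
Variable C : preadditive_cat.

Definition is_iso (X Y : C) (f : hom X Y) : Prop :=
  exists g : hom Y X, g ∘ f = idm X /\ f ∘ g = idm Y.

Definition isomorphic (X Y : C) : Prop := exists f : hom X Y, is_iso f.

(* Initial and terminal: hom-groups are inhabited, so uniqueness of the       *)
(* morphism amounts to every morphism being 0.                                *)
Definition is_zero (X : C) : Prop :=
  forall Y : C, (forall f : hom X Y, f = 0) /\ (forall f : hom Y X, f = 0).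

Definition is_biproduct (X Y B : C) (i1 : hom X B) (i2 : hom Y B)
    (p1 : hom B X) (p2 : hom B Y) : Prop :=
  [/\ p1 ∘ i1 = idm X, p2 ∘ i2 = idm Y, p2 ∘ i1 = 0, p1 ∘ i2 = 0
    & i1 ∘ p1 + i2 ∘ p2 = idm B].

Definition is_coproduct (J : Type) (X : J -> C) (c : C)
    (inj : forall j, hom (X j) c) : Prop :=
  forall (Y : C) (f : forall j, hom (X j) Y),
    exists! u : hom c Y, forall j, u ∘ inj j = f j.

End Basics.

Record functor (C D : preadditive_cat) := Functor {
  fobj :> C -> D;
  fmap : forall X Y : C, hom X Y -> hom (fobj X) (fobj Y);
  fmap1 : forall X : C, fmap (idm X) = idm (fobj X);
  fmap_comp : forall (X Y Z : C) (g : hom Y Z) (f : hom X Y),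
    fmap (g ∘ f) = fmap g ∘ fmap f
}.

Arguments fmap {C D} F {X Y} f : rename.

Definition idF (C : preadditive_cat) : functor C C :=
  @Functor C C (fun X => X) (fun _ _ f => f)
    (fun _ => erefl) (fun _ _ _ _ _ => erefl).

Lemma compF1 (C D E : preadditive_cat) (G : functor D E) (F : functor C D) (X : C) :
  fmap G (fmap F (idm X)) = idm (G (F X)).
Proof. by rewrite !fmap1. Qed.

Lemma compF_comp (C D E : preadditive_cat) (G : functor D E) (F : functor C D)
    (X Y Z : C) (g : hom Y Z) (f : hom X Y) :
  fmap G (fmap F (g ∘ f)) = fmap G (fmap F g) ∘ fmap G (fmap F f).
Proof. by rewrite !fmap_comp. Qed.

Definition compF (C D E : preadditive_cat) (G : functor D E) (F : functor C D) :
    functor C E :=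
  @Functor C E (fun X => G (F X)) (fun _ _ f => fmap G (fmap F f))
    (compF1 G F) (compF_comp G F).

Section Functors.
Variables C D : preadditive_cat.

Definition additive_functor (F : functor C D) : Prop :=
  forall (X Y : C) (f g : hom X Y), fmap F (f + g) = fmap F f + fmap F g.

Definition natural (F G : functor C D) (t : forall X, hom (F X) (G X)) : Prop :=
  forall (X Y : C) (f : hom X Y), t Y ∘ fmap F f = fmap G f ∘ t X.

Definition nat_isomorphic (F G : functor C D) : Prop :=
  exists t : forall X, hom (F X) (G X),
    natural t /\ forall X, is_iso (t X).

Definition preserves_coproducts (F : functor C D) : Prop :=
  forall (J : smallType) (X : J -> C) (c : C) (inj : forall j, hom (X j) c),
    is_coproduct inj ->
    @is_coproduct D J (fun j => F (X j)) (F c) (fun j => fmap F (inj j)).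

End Functors.

Definition is_equivalence (C D : preadditive_cat) (F : functor C D) : Prop :=
  exists G : functor D C,
    nat_isomorphic (compF G F) (idF C) /\ nat_isomorphic (compF F G) (idF D).

(* [adjoint L R]: L is left adjoint to R, by unit, counit and the triangle    *)
(* identities.                                                                *)
Definition adjoint (C D : preadditive_cat) (L : functor C D) (R : functor D C) :
    Prop :=
  exists (eta : forall X : C, hom X (R (L X)))
         (eps : forall Y : D, hom (L (R Y)) Y),
    [/\ @natural C C (idF C) (compF R L) eta,
        @natural D D (compF L R) (idF D) eps,
        forall X : C, eps (L X) ∘ fmap L (eta X) = idm (L X)
      & forall Y : D, fmap R (eps Y) ∘ eta (R Y) = idm (R Y)].

Record additive_cat := AdditiveCat {
  add_preadd :> preadditive_cat;
  zero_exists : exists Z : add_preadd, is_zero Z;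
  biproduct_exists : forall X Y : add_preadd,
    exists (B : add_preadd) (i1 : hom X B) (i2 : hom Y B)
           (p1 : hom B X) (p2 : hom B Y), is_biproduct i1 i2 p1 p2
}.

(* Verdier's axioms, for a suspension that is an additive auto-equivalence    *)
(* (not necessarily an automorphism).  [dist f g h] means that                *)
(* X --f--> Y --g--> Z --h--> S X is a distinguished triangle.                *)
Record triangulated_cat := TriangulatedCat {
  tri_add :> additive_cat;
  susp : functor tri_add tri_add;
  susp_additive : additive_functor susp;
  susp_equiv : is_equivalence susp;
  dist : forall X Y Z : tri_add, hom X Y -> hom Y Z -> hom Z (susp X) -> Prop;
  dist_iso : forall (X Y Z X' Y' Z' : tri_add)
    (f : hom X Y) (g : hom Y Z) (h : hom Z (susp X))
    (f' : hom X' Y') (g' : hom Y' Z') (h' : hom Z' (susp X'))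
    (a : hom X X') (b : hom Y Y') (c : hom Z Z'),
    is_iso a -> is_iso b -> is_iso c ->
    b ∘ f = f' ∘ a -> c ∘ g = g' ∘ b -> fmap susp a ∘ h = h' ∘ c ->
    dist f g h -> dist f' g' h';
  dist_id : forall X Z : tri_add, is_zero Z ->
    dist (idm X) (0 : hom X Z) (0 : hom Z (susp X));
  dist_cone : forall (X Y : tri_add) (f : hom X Y),
    exists (Z : tri_add) (g : hom Y Z) (h : hom Z (susp X)), dist f g h;
  dist_rot : forall (X Y Z : tri_add)
    (f : hom X Y) (g : hom Y Z) (h : hom Z (susp X)),
    dist f g h <-> dist g h (- fmap susp f);
  dist_mor : forall (X Y Z X' Y' Z' : tri_add)
    (f : hom X Y) (g : hom Y Z) (h : hom Z (susp X))
    (f' : hom X' Y') (g' : hom Y' Z') (h' : hom Z' (susp X'))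
    (a : hom X X') (b : hom Y Y'),
    dist f g h -> dist f' g' h' -> b ∘ f = f' ∘ a ->
    exists c : hom Z Z', c ∘ g = g' ∘ b /\ fmap susp a ∘ h = h' ∘ c;
  dist_octahedron : forall (X Y Z X' Y' Z' : tri_add)
    (f : hom X Y) (u : hom Y Z') (u' : hom Z' (susp X))
    (g : hom Y Z) (v : hom Z X') (v' : hom X' (susp Y))
    (w : hom Z Y') (w' : hom Y' (susp X)),
    dist f u u' -> dist g v v' -> dist (g ∘ f) w w' ->
    exists (a : hom Z' Y') (b : hom Y' X'),
      dist a b (fmap susp u ∘ v') /\
      [/\ a ∘ u = w ∘ g, w' ∘ a = u', b ∘ w = v & v' ∘ b = fmap susp f ∘ w']
}.

Arguments susp {_}.
Arguments dist {_ X Y Z} f g h.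

Definition triangulated_functor (C D : triangulated_cat) (F : functor C D) : Prop :=
  additive_functor F /\
  exists phi : forall X : C, hom (F (susp X)) (susp (F X)),
    [/\ @natural C D (compF F susp) (compF susp F) phi,
        forall X, is_iso (phi X)
      & forall (X Y Z : C) (f : hom X Y) (g : hom Y Z) (h : hom Z (susp X)),
          dist f g h -> dist (fmap F f) (fmap F g) (phi X ∘ fmap F h)].

Record symmetric_monoidal (C : preadditive_cat) := SymmetricMonoidal {
  tunit : C;
  tens : C -> C -> C;
  tensm : forall X X' Y Y' : C,
    hom X X' -> hom Y Y' -> hom (tens X Y) (tens X' Y');
  assoc : forall X Y Z : C, hom (tens (tens X Y) Z) (tens X (tens Y Z));
  lunit : forall X : C, hom (tens tunit X) X;
  runit : forall X : C, hom (tens X tunit) X;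
  braid : forall X Y : C, hom (tens X Y) (tens Y X);
  tensm1 : forall X Y : C, tensm (idm X) (idm Y) = idm (tens X Y);
  tensm_comp : forall (X X' X'' Y Y' Y'' : C)
    (f' : hom X' X'') (f : hom X X') (g' : hom Y' Y'') (g : hom Y Y'),
    tensm (f' ∘ f) (g' ∘ g) = tensm f' g' ∘ tensm f g;
  assoc_iso : forall X Y Z, is_iso (assoc X Y Z);
  lunit_iso : forall X, is_iso (lunit X);
  runit_iso : forall X, is_iso (runit X);
  assoc_nat : forall (X X' Y Y' Z Z' : C)
    (f : hom X X') (g : hom Y Y') (h : hom Z Z'),
    assoc X' Y' Z' ∘ tensm (tensm f g) h =
    tensm f (tensm g h) ∘ assoc X Y Z;
  lunit_nat : forall (X X' : C) (f : hom X X'),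
    lunit X' ∘ tensm (idm tunit) f = f ∘ lunit X;
  runit_nat : forall (X X' : C) (f : hom X X'),
    runit X' ∘ tensm f (idm tunit) = f ∘ runit X;
  braid_nat : forall (X X' Y Y' : C) (f : hom X X') (g : hom Y Y'),
    braid X' Y' ∘ tensm f g = tensm g f ∘ braid X Y;
  braid_sym : forall X Y : C, braid Y X ∘ braid X Y = idm (tens X Y);
  pentagon : forall W X Y Z : C,
    assoc W X (tens Y Z) ∘ assoc (tens W X) Y Z =
    tensm (idm W) (assoc X Y Z) ∘ assoc W (tens X Y) Z
      ∘ tensm (assoc W X Y) (idm Z);
  unit_triangle : forall X Y : C,
    tensm (idm X) (lunit Y) ∘ assoc X tunit Y = tensm (runit X) (idm Y);
  hexagon : forall X Y Z : C,
    assoc Y Z X ∘ braid X (tens Y Z) ∘ assoc X Y Z =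
    tensm (idm Y) (braid X Z) ∘ assoc Y X Z ∘ tensm (braid X Y) (idm Z)
}.

Section TensorFunctors.
Variables (C : preadditive_cat) (M : symmetric_monoidal C).

Lemma tensl_comp (A X Y Z : C) (g : hom Y Z) (f : hom X Y) :
  tensm M (idm A) (g ∘ f) = tensm M (idm A) g ∘ tensm M (idm A) f.
Proof. by rewrite -tensm_comp ccomp1m. Qed.

Lemma tensr_comp (A X Y Z : C) (g : hom Y Z) (f : hom X Y) :
  tensm M (g ∘ f) (idm A) = tensm M g (idm A) ∘ tensm M f (idm A).
Proof. by rewrite -tensm_comp ccomp1m. Qed.

(* The functor A ⊗ - *)
Definition tensl (A : C) : functor C C :=
  @Functor C C (fun X => tens M A X) (fun _ _ f => tensm M (idm A) f)
    (fun X => tensm1 M A X) (@tensl_comp A).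

(* The functor - ⊗ A *)
Definition tensr (A : C) : functor C C :=
  @Functor C C (fun X => tens M X A) (fun _ _ f => tensm M f (idm A))
    (fun X => tensm1 M X A) (@tensr_comp A).

End TensorFunctors.

Definition strong_monoidal (C D : preadditive_cat) (M : symmetric_monoidal C)
    (N : symmetric_monoidal D) (F : functor C D) : Prop :=
  exists (mu : forall X Y : C, hom (tens N (F X) (F Y)) (F (tens M X Y)))
         (eps : hom (tunit N) (F (tunit M))),
    [/\ is_iso eps,
        forall X Y, is_iso (mu X Y),
        forall (X X' Y Y' : C) (f : hom X X') (g : hom Y Y'),
          mu X' Y' ∘ tensm N (fmap F f) (fmap F g) =
          fmap F (tensm M f g) ∘ mu X Y,
        forall X Y Z : C,
          fmap F (assoc M X Y Z) ∘ mu (tens M X Y) Z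
            ∘ tensm N (mu X Y) (idm (F Z)) =
          mu X (tens M Y Z) ∘ tensm N (idm (F X)) (mu Y Z)
            ∘ assoc N (F X) (F Y) (F Z)
      & forall X : C,
          fmap F (lunit M X) ∘ mu (tunit M) X ∘ tensm N eps (idm (F X)) =
            lunit N (F X) /\
          fmap F (runit M X) ∘ mu X (tunit M) ∘ tensm N (idm (F X)) eps =
            runit N (F X)].

Record ttcat := TTCat {
  tt_tri :> triangulated_cat;
  tt_mon : symmetric_monoidal tt_tri;
  tensl_exact : forall A : tt_tri, triangulated_functor (tensl tt_mon A);
  tensr_exact : forall A : tt_tri, triangulated_functor (tensr tt_mon A)
}.

(* A tt-category with small coproducts, with ⊗ commuting with coproducts in   *)
(* each variable.                                                             *)
Record ttcat_coprod := TTCatCoprod {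
  ttc_tt :> ttcat;
  coprod : forall J : smallType, (J -> ttc_tt) -> ttc_tt;
  coprod_inj : forall (J : smallType) (X : J -> ttc_tt) (j : J),
    hom (X j) (coprod X);
  coprodP : forall (J : smallType) (X : J -> ttc_tt),
    is_coproduct (coprod_inj X);
  tensl_coprod : forall A : ttc_tt, preserves_coproducts (tensl (tt_mon ttc_tt) A);
  tensr_coprod : forall A : ttc_tt, preserves_coproducts (tensr (tt_mon ttc_tt) A)
}.

Arguments coprod {_ J} X.
Arguments coprod_inj {_ J} X j.

Notation "x ⊗ y" := (tens (tt_mon _) x y)
  (at level 40, left associativity) : cat_scope.
Notation "'𝟙_' T" := (tunit (tt_mon T)) (at level 8, T at level 2) : cat_scope.

Definition tt_functor (S T : ttcat) (F : functor S T) : Prop :=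
  triangulated_functor F /\ strong_monoidal (tt_mon S) (tt_mon T) F.

Section Localizing.
Variable T : ttcat_coprod.
Local Open Scope classical_set_scope.

(* Full subcategories are given by their sets of objects, and are replete.    *)
(* Closure under cones in the other two positions follows by rotation.        *)
Definition triangulated_subcategory (P : set T) : Prop :=
  [/\ forall X Y : T, isomorphic X Y -> P X -> P Y,
      forall X : T, is_zero X -> P X,
      forall X : T, P (susp X) <-> P X
    & forall (X Y Z : T) (f : hom X Y) (g : hom Y Z) (h : hom Z (susp X)),
        dist f g h -> P X -> P Y -> P Z].

Definition localizing_subcategory (P : set T) : Prop :=
  triangulated_subcategory P /\
  forall (J : smallType) (X : J -> T) (c : T) (inj : forall j, hom (X j) c),
    is_coproduct inj -> (forall j, P (X j)) -> P c.

Definition localizing_tensor_ideal (P : set T) : Prop :=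
  localizing_subcategory P /\ forall X Y : T, P X -> P (X ⊗ Y).

Definition Loc_tens (A : set T) : set T := smallest localizing_tensor_ideal A.

End Localizing.

Notation "'Loc⊗' A" := (Loc_tens A) (at level 10, A at level 8) : cat_scope.

(* Main.v *)
(* If M is a localizing tensor-ideal containing y, then {z | x ⊗ z in M} is
   one too, so x lies in M as soon as x ⊗ g_i(1) does for every i; by the
   projection formula this object is g_i(f_i(x) ⊗ 1).  Now
   {z | g_i(z ⊗ w) in M for all w} is a localizing tensor-ideal containing
   f_i(y), because g_i(f_i(y) ⊗ w) is y ⊗ g_i(w), hence it contains f_i(x).
   That this preimage is closed under cones uses that an adjoint of an exact
   functor is exact (a five-lemma chase).  Detection is building applied to a
   zero object y, since the zero objects form a localizing tensor-ideal. *)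
From mathcomp Require Import all_boot all_algebra.
From mathcomp Require Import boolp classical_sets.
Require Import Defs.
Set Implicit Arguments.
Unset Strict Implicit.
Unset Printing Implicit Defensive.
Import GRing.Theory.
Local Open Scope ring_scope.
Local Open Scope classical_set_scope.
Local Open Scope cat_scope.

(** * Preadditive categories: zero objects and isomorphisms *)

Section Preadditive.
Variable C : preadditive_cat.
Implicit Types X Y Z : C.

Lemma comp0m X Y Z (f : hom X Y) : (0 : hom Y Z) ∘ f = 0.
Proof. by apply: (@addrI _ (0 ∘ f)); rewrite -ccompDl !addr0. Qed.

Lemma compm0 X Y Z (g : hom Y Z) : g ∘ (0 : hom X Y) = 0.
Proof. by apply: (@addrI _ (g ∘ 0)); rewrite -ccompDr !addr0. Qed.

Lemma compNm X Y Z (g : hom Y Z) (f : hom X Y) : (- g) ∘ f = - (g ∘ f).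
Proof. by apply: (@addrI _ (g ∘ f)); rewrite -ccompDl !subrr comp0m. Qed.

Lemma compmN X Y Z (g : hom Y Z) (f : hom X Y) : g ∘ (- f) = - (g ∘ f).
Proof. by apply: (@addrI _ (g ∘ f)); rewrite -ccompDr !subrr compm0. Qed.

Lemma is_zero_id X : idm X = 0 -> is_zero X.
Proof.
by move=> X0 Y; split=> f; [rewrite -(ccompm1 f) | rewrite -(ccomp1m f)];
  rewrite X0 ?compm0 ?comp0m.
Qed.

Lemma isomorphic_sym X Y : isomorphic X Y -> isomorphic Y X.
Proof. by case=> f [g [gf fg]]; exists g, f. Qed.

Lemma isomorphic_trans Y X Z :
  isomorphic X Y -> isomorphic Y Z -> isomorphic X Z.
Proof.
case=> f [g [gf fg]] [f' [g' [gf' fg']]]; exists (f' ∘ f), (g ∘ g').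
by rewrite -!ccompA (ccompA g') gf' ccomp1m (ccompA f) fg ccomp1m.
Qed.

Lemma is_zero_iso X Y : isomorphic X Y -> is_zero X -> is_zero Y.
Proof.
case=> f [g [_ fg]] X0; apply: is_zero_id.
by rewrite -fg (proj1 (X0 _) f) comp0m.
Qed.

(** A preimage [g] of the identity is a section of [f], and [f] kills [g ∘ f - 1]. The kernel form
    of injectivity is what a diagram chase delivers. *)
Lemma is_iso_postcomp X Y (f : hom X Y) :
  (forall A (t : hom A X), f ∘ t = 0 -> t = 0) ->
  (forall A (s : hom A Y), exists t, f ∘ t = s) -> is_iso f.
Proof.
move=> f_mono f_surj; have [g fg] := f_surj _ (idm Y); exists g; split=> //.
apply/eqP; rewrite -subr_eq0; apply/eqP/f_mono.
by rewrite ccompDr compmN ccompA fg ccomp1m ccompm1 subrr.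
Qed.

Lemma is_iso_precomp X Y (f : hom X Y) :
  (forall A (t : hom Y A), t ∘ f = 0 -> t = 0) ->
  (forall A (s : hom X A), exists t, t ∘ f = s) -> is_iso f.
Proof.
move=> f_epi f_surj; have [g gf] := f_surj _ (idm X); exists g; split=> //.
apply/eqP; rewrite -subr_eq0; apply/eqP/f_epi.
by rewrite ccompDl compNm -ccompA gf ccomp1m ccompm1 subrr.
Qed.

End Preadditive.

(** * Additive functors and adjunctions *)

Section Functors.
Variables C D : preadditive_cat.

Lemma fmap_isomorphic (F : functor C D) (X Y : C) :
  isomorphic X Y -> isomorphic (F X) (F Y).
Proof.
by case=> f [g [gf fg]]; exists (fmap F f), (fmap F g); rewrite -!fmap_comp gf fg !fmap1.
Qed.

Lemma additive_fmap0 (F : functor C D) (X Y : C) :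
  additive_functor F -> fmap F (0 : hom X Y) = 0.
Proof. by move=> Fadd; apply: (@addrI _ (fmap F 0)); rewrite -Fadd !addr0. Qed.

Lemma additive_is_zero (F : functor C D) (X : C) :
  additive_functor F -> is_zero X -> is_zero (F X).
Proof.
move=> Fadd X0; apply: is_zero_id.
by rewrite -fmap1 (proj1 (X0 X) (idm X)) additive_fmap0.
Qed.

(** The hom-set form of the adjunction, natural in both variables; the chases below move morphisms
    across it. *)
Lemma adjoint_transpose (L : functor C D) (R : functor D C) :
  adjoint L R ->
  exists (tr : forall A Z, hom (L A) Z -> hom A (R Z))
         (rt : forall A Z, hom A (R Z) -> hom (L A) Z),
    [/\ forall A Z, cancel (@tr A Z) (@rt A Z) /\ cancel (@rt A Z) (@tr A Z),
        forall A Z Z' (z : hom Z Z') (u : hom (L A) Z),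
          tr _ _ (z ∘ u) = fmap R z ∘ tr _ _ u,
        forall A A' Z (u : hom (L A) Z) (a : hom A' A),
          tr _ _ (u ∘ fmap L a) = tr _ _ u ∘ a,
        forall A Z Z' (z : hom Z Z') (t : hom A (R Z)),
          rt _ _ (fmap R z ∘ t) = z ∘ rt _ _ t
      & forall A A' Z (t : hom A (R Z)) (a : hom A' A),
          rt _ _ (t ∘ a) = rt _ _ t ∘ fmap L a].
Proof.
case=> eta [eps [eta_nat eps_nat eps_eta eta_eps]].
exists (fun A Z u => fmap R u ∘ eta A), (fun A Z t => eps Z ∘ fmap L t).
split=> [A Z|A Z Z' z u|A A' Z u a|A Z Z' z t|A A' Z t a].
- split=> u.
  + by rewrite fmap_comp ccompA (eps_nat _ _ u) -ccompA eps_eta ccompm1.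
  + by rewrite fmap_comp -ccompA -(eta_nat _ _ u) ccompA eta_eps ccomp1m.
- by rewrite fmap_comp ccompA.
- by rewrite fmap_comp -!ccompA; congr (_ ∘ _); rewrite -(eta_nat _ _ a).
- by rewrite fmap_comp ccompA (eps_nat _ _ z) -ccompA.
- by rewrite fmap_comp ccompA.
Qed.

End Functors.

(** * The suspension and long exact hom sequences *)

Section Triangles.
Variable T : triangulated_cat.
Implicit Types X Y Z : T.

Lemma susp_faithful X Y (f g : hom X Y) :
  fmap susp f = fmap susp g -> f = g.
Proof.
have [G [[t [t_nat t_iso]] _]] := susp_equiv T.
move=> Sfg; have [s [_ ts]] := t_iso X.
have /= tf := t_nat _ _ f; have /= tg := t_nat _ _ g.
by rewrite -(ccompm1 f) -(ccompm1 g) -ts !ccompA -tf -tg Sfg.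
Qed.

(** Conjugating [fmap G u] by [t] gives [f]. Then [fmap G] agrees on [u] and [fmap susp f], and [t']
    makes [G] faithful. *)
Lemma susp_full X Y (u : hom (susp X) (susp Y)) : exists f, u = fmap susp f.
Proof.
have [G [[t [t_nat t_iso]] [t' [t'_nat t'_iso]]]] := susp_equiv T.
have [s [st ts]] := t_iso X; have [r [rt tr]] := t_iso Y.
pose f := t Y ∘ fmap G u ∘ s.
exists f.
have GSf : fmap G (fmap susp f) = fmap G u.
  have /= /(congr1 (fun v => r ∘ v)) := t_nat _ _ f.
  rewrite ccompA rt ccomp1m => ->.
  by rewrite /f -!ccompA st ccompm1 !ccompA rt ccomp1m.
have [s' [_ ts']] := t'_iso (susp X).
have /= e1 := t'_nat _ _ u; have /= e2 := t'_nat _ _ (fmap susp f).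
by rewrite -(ccompm1 u) -(ccompm1 (fmap susp f)) -ts' !ccompA -e1 -e2 GSf.
Qed.

Lemma susp_ess_surj Y : exists X, isomorphic (susp X) Y.
Proof.
have [G [_ [t [_ t_iso]]]] := susp_equiv T.
exists (G Y); exists (t Y); exact: t_iso.
Qed.

Lemma is_zero_susp X : is_zero (susp X) -> is_zero X.
Proof.
move=> SX0; apply: is_zero_id; apply: susp_faithful.
by rewrite (proj1 (SX0 _) (fmap susp (idm X))) (proj1 (SX0 _) (fmap susp 0)).
Qed.

Section Triangle.
Variables (X Y Z : T) (f : hom X Y) (g : hom Y Z) (h : hom Z (susp X)).
Hypothesis fgh : dist f g h.

Lemma dist_comp0 : g ∘ f = 0.
Proof.
have [O O0] := zero_exists T.
have [|c [cg _]] := dist_mor (a := idm X) (b := f) (dist_id X O0) fgh.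
  by [].
by rewrite -cg compm0.
Qed.

(** Completing [t] to a morphism from the rotated triangle on [idm A] gives a map between
    suspensions, which desuspends to [s]. *)
Lemma dist_lift A (t : hom A Y) : g ∘ t = 0 -> exists s, t = f ∘ s.
Proof.
move=> gt; have [O O0] := zero_exists T.
have d := proj1 (dist_rot _ _ _) (dist_id A O0).
have [|c [_ cS]] := dist_mor (a := t) (b := 0) d (proj1 (dist_rot _ _ _) fgh).
  by rewrite compm0 gt.
have [s cs] := susp_full c; exists s; apply: susp_faithful; apply: oppr_inj.
by rewrite fmap_comp -cs -compNm -cS fmap1 compmN ccompm1.
Qed.

Lemma dist_extend A (t : hom Y A) : t ∘ f = 0 -> exists s, t = s ∘ g.
Proof.
move=> tf; have [O O0] := zero_exists T.
have d : dist (0 : hom O A) (idm A) 0.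
  apply/dist_rot; rewrite (additive_fmap0 _ _ (@susp_additive T)) oppr0.
  exact/dist_id/additive_is_zero/O0/(@susp_additive T).
have [|c [cg _]] := dist_mor (a := 0) (b := t) fgh d.
  by rewrite tf compm0.
by exists c; rewrite cg ccomp1m.
Qed.

End Triangle.

Section RotatedTriangle.
Variables (X Y Z : T) (f : hom X Y) (g : hom Y Z) (h : hom Z (susp X)).
Hypothesis fgh : dist f g h.

Let ghf : dist g h (- fmap susp f).
Proof. exact: (proj1 (dist_rot _ _ _)). Qed.

Let hfg : dist h (- fmap susp f) (- fmap susp g).
Proof. exact: (proj1 (dist_rot _ _ _)). Qed.

(** Rotating twice turns [f] into [- fmap susp f]; this lemma and the next two absorb the sign. *)
Lemma dist_comp0_susp : fmap susp f ∘ h = 0.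
Proof. by apply: oppr_inj; rewrite oppr0 -compNm (dist_comp0 hfg). Qed.

Lemma dist_lift_susp A (t : hom A (susp X)) :
  fmap susp f ∘ t = 0 -> exists s, t = h ∘ s.
Proof. by move=> ft; apply: (dist_lift hfg); rewrite compNm ft oppr0. Qed.

Lemma dist_extend_susp A (t : hom (susp X) A) :
  t ∘ h = 0 -> exists s, t = s ∘ fmap susp f.
Proof.
by case/(dist_extend hfg)=> s ->; exists (- s); rewrite compNm compmN.
Qed.

End RotatedTriangle.
End Triangles.

(** * Functors compatible with cones *)

(* Weaker than [triangulated_functor]: the isomorphism with the suspension need
   not be natural, and the triangle on [fmap F f] need not be the image of the
   given one.  This is all that pulling back localizing subcategories needs. *)
Record cone_preserving (C D : triangulated_cat) (F : functor C D) : Prop :=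
  ConePreserving {
  cp_zero : forall X, is_zero X -> is_zero (F X);
  cp_susp : forall X, isomorphic (F (susp X)) (susp (F X));
  cp_cone : forall (X Y Z : C) (f : hom X Y) (g : hom Y Z) (h : hom Z (susp X)),
    dist f g h -> exists g' (h' : hom (F Z) _), dist (fmap F f) g' h'
}.

Lemma cone_preserving_comp (C D E : triangulated_cat) (G : functor D E)
    (F : functor C D) :
  cone_preserving G -> cone_preserving F -> cone_preserving (compF G F).
Proof.
move=> [G0 GS Gc] [F0 FS Fc]; split=> [X /F0/G0 //|X|X Y Z f g h].
  exact: isomorphic_trans (fmap_isomorphic G (FS X)) (GS _).
by case/Fc=> g' [h' /Gc].
Qed.

Lemma triangulated_cone_preserving (C D : triangulated_cat) (F : functor C D) :
  triangulated_functor F -> cone_preserving F.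
Proof.
case=> Fadd [phi [_ phi_iso phi_dist]]; split=> [X|X|X Y Z f g h d].
- exact: additive_is_zero.
- by exists (phi X).
- by exists (fmap F g), (phi X ∘ fmap F h); apply: phi_dist.
Qed.

Lemma dist_iso3 (T : triangulated_cat) (X Y W Z : T) (f : hom X Y) (p : hom Y W)
    (q : hom W (susp X)) :
  dist f p q -> isomorphic W Z ->
  exists (g : hom Y Z) (h : hom Z (susp X)), dist f g h.
Proof.
move=> d [c [b [bc cb]]]; exists (c ∘ p), (q ∘ b).
apply: (dist_iso (a := idm X) (b := idm Y) (c := c)) d.
- by exists (idm X); rewrite !ccomp1m.
- by exists (idm Y); rewrite !ccomp1m.
- by exists b.
- by rewrite ccomp1m ccompm1.
- by rewrite ccompm1.
- by rewrite fmap1 ccomp1m -ccompA bc ccompm1.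
Qed.

(** * Adjoints of exact functors *)

Section Adjoints.
Variables (C D : triangulated_cat) (F : functor C D) (G : functor D C).
Hypothesis F_tri : triangulated_functor F.

(** Let [W] be a cone of [fmap G x]. The counits extend to a morphism of triangles with third
    component [c] from [F W] to [Z], and a five-lemma chase on maps out of a test object shows that
    the transpose of [c] is an isomorphism from [W] to [G Z]. *)
Lemma right_adjoint_cone_preserving : adjoint F G -> cone_preserving G.
Proof.
case: F_tri => Fadd [phi [phi_nat phi_iso phi_dist]].
case/adjoint_transpose=> tr [rt [trK tr_l tr_r rt_l rt_r]].
have trI A Z := can_inj (proj1 (trK A Z)).
have rtI A Z := can_inj (proj2 (trK A Z)).
have rt0 A Z : rt A Z 0 = 0.
  by rewrite -[X in rt _ _ X](comp0m (G Z) (0 : hom A (G Z))) rt_r additive_fmap0 ?compm0.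
have tr0 A Z : tr A Z 0 = 0 by apply: rtI; rewrite (proj1 (trK _ _)) rt0.
(* [ev] is the counit, [theta] the mate of [phi], invertible as [phi] is. *)
pose ev X : hom (F (G X)) X := rt _ _ (idm (G X)).
have evE A X (t : hom A (G X)) : ev X ∘ fmap F t = rt _ _ t.
  by rewrite -rt_r ccomp1m.
pose theta X : hom (susp (G X)) (G (susp X)) := tr _ _ (fmap susp (ev X) ∘ phi (G X)).
have thetaE A X (t : hom A (susp (G X))) :
    rt _ _ (theta X ∘ t) = fmap susp (ev X) ∘ phi (G X) ∘ fmap F t.
  by rewrite rt_r (proj1 (trK _ _)).
have theta_susp B X (t : hom B (G X)) :
    rt _ _ (theta X ∘ fmap susp t) = fmap susp (rt _ _ t) ∘ phi B.
  rewrite thetaE -evE fmap_comp -!ccompA; congr (_ ∘ _).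
  exact: (phi_nat _ _ t).
(* Up to isomorphism [A] is some [susp B]. There, by [theta_susp], composing with [theta X] amounts
   across the adjunction to suspending and composing with the invertible [phi B]. *)
have theta_mono X A (t : hom A (susp (G X))) : theta X ∘ t = 0 -> t = 0.
  have [B [a [b [_ ab]]]] := susp_ess_surj A.
  have [t0 t0E] := susp_full (t ∘ a).
  move=> theta_t; have := theta_susp _ _ t0.
  rewrite -t0E ccompA theta_t comp0m rt0 => e.
  suff: t0 = 0.
    move=> t00; rewrite -(ccompm1 t) -ab ccompA t0E t00.
    by rewrite (additive_fmap0 _ _ (@susp_additive C)) comp0m.
  apply: rtI; rewrite rt0; apply: susp_faithful.
  rewrite (additive_fmap0 _ _ (@susp_additive D)).
  have [psi [_ phipsi]] := phi_iso B.
  by rewrite -(ccompm1 (fmap _ _)) -phipsi ccompA -e comp0m.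
have theta_surj X A (s : hom A (G (susp X))) : exists t, theta X ∘ t = s.
  have [B [a [b [_ ab]]]] := susp_ess_surj A.
  have [psi [psiphi _]] := phi_iso B.
  have [u uE] := susp_full (rt _ _ (s ∘ a) ∘ psi).
  exists (fmap susp (tr _ _ u) ∘ b).
  rewrite ccompA -[RHS]ccompm1 -ab [RHS]ccompA; congr (_ ∘ _); apply: rtI.
  by rewrite theta_susp (proj1 (trK _ _)) -uE -ccompA psiphi ccompm1.
have theta_nat X Y (x : hom X Y) :
    theta Y ∘ fmap susp (fmap G x) = fmap G (fmap susp x) ∘ theta X.
  apply: rtI; rewrite theta_susp rt_l /theta (proj1 (trK _ _)) ccompA.
  by rewrite -fmap_comp -rt_l ccompm1.
split=> [X X0|X|X Y Z x y z xyz].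
- by apply: is_zero_id; apply: rtI; rewrite (proj2 (X0 _) (rt _ _ 0)); apply: (proj2 (X0 _)).
- apply: isomorphic_sym; exists (theta X); apply: is_iso_postcomp => A t.
  + exact: theta_mono.
  + exact: theta_surj.
have [W [p [q xpq]]] := dist_cone (fmap G x).
have xpq1 := proj1 (dist_rot _ _ _) xpq; have xyz1 := proj1 (dist_rot _ _ _) xyz.
have [|c [cp cq]] := dist_mor (a := ev X) (b := ev Y) (phi_dist _ _ _ _ _ _ xpq) xyz.
  by rewrite evE -rt_l ccompm1.
have tcp : tr _ _ c ∘ p = fmap G y.
  by apply: rtI; rewrite rt_r (proj1 (trK _ _)) cp -rt_l ccompm1.
have tcq : fmap G z ∘ tr _ _ c = theta X ∘ q.
  by apply: rtI; rewrite rt_l thetaE (proj1 (trK _ _)) -cq ccompA.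
(* Maps from [A] into the image under [G] of a triangle are maps from [F A] into the triangle
   itself, so exactness holds before the image is known to be distinguished. *)
have lift A X1 X2 X3 (x1 : hom X1 X2) (x2 : hom X2 X3) x3 (t : hom A (G X2)) :
    dist x1 x2 x3 -> fmap G x2 ∘ t = 0 -> exists r, t = fmap G x1 ∘ r.
  move=> d e; have [|r rE] := dist_lift d (t := rt _ _ t).
    by rewrite -rt_l e rt0.
  by exists (tr _ _ r); rewrite -tr_l -rE (proj2 (trK _ _)).
apply: (dist_iso3 xpq); exists (tr _ _ c); apply: is_iso_postcomp => A t.
  (* Injectivity: [t] factors as [p ∘ s], then [s] through [fmap G x], and [p] kills [fmap G x]. *)
  move=> ct; have [|s tE] := dist_lift xpq1 (t := t).
    by apply: theta_mono; rewrite ccompA -tcq -ccompA ct compm0.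
  have [|r sE] := lift _ _ _ _ _ _ _ s xyz.
    by rewrite -tcp -ccompA -tE.
  by rewrite tE sE ccompA (dist_comp0 xpq) comp0m.
(* Surjectivity: [t''] lifts the image of [t] in the suspension, and the error [t - tr _ _ c ∘ t'']
   comes from [G Y], where [p] corrects it. *)
have [t' t'E] := theta_surj _ _ (fmap G z ∘ t).
have [|t'' t''E] := dist_lift_susp xpq (t := t').
  apply: theta_mono; rewrite ccompA theta_nat -ccompA t'E; apply: rtI.
  by rewrite !rt_l rt0 ccompA (dist_comp0_susp xyz) comp0m.
have [|r rE] := lift _ _ _ _ _ _ _ (t - tr _ _ c ∘ t'') xyz1.
  by rewrite ccompDr compmN ccompA tcq -ccompA -t''E t'E subrr.
exists (t'' + p ∘ r).
by rewrite ccompDr ccompA tcp -rE addrC subrK.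
Qed.


(** Dual to the right adjoint case: units replace counits, the chase uses maps into a test object,
    and the mate is built from the inverse [psi] of [phi]. *)
Lemma left_adjoint_cone_preserving : adjoint G F -> cone_preserving G.
Proof.
case: F_tri => Fadd [phi [phi_nat phi_iso phi_dist]].
case/adjoint_transpose=> tr [rt [trK tr_l tr_r rt_l rt_r]].
have trI A Z := can_inj (proj1 (trK A Z)).
have rtI A Z := can_inj (proj2 (trK A Z)).
have tr0 A Z : tr A Z 0 = 0.
  by rewrite -[X in tr _ _ X](comp0m Z (0 : hom (G A) Z)) tr_l additive_fmap0 ?comp0m.
pose psi X := sval (cid (phi_iso X)).
have psiphi X : psi X ∘ phi X = idm _ by rewrite /psi; case: cid => ? [].
have phipsi X : phi X ∘ psi X = idm _ by rewrite /psi; case: cid => ? [].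
have psi_nat X Y (f : hom X Y) :
    fmap F (fmap susp f) ∘ psi X = psi Y ∘ fmap susp (fmap F f).
  rewrite -[LHS]ccomp1m -psiphi -!ccompA; congr (_ ∘ _).
  by rewrite ccompA (phi_nat _ _ f) -ccompA phipsi ccompm1.
(* [co] is the unit, [theta] the mate of [psi], invertible as [psi] is. *)
pose co X : hom X (F (G X)) := tr _ _ (idm (G X)).
have coE A X (t : hom (G X) A) : fmap F t ∘ co X = tr _ _ t.
  by rewrite -tr_l ccompm1.
pose theta X : hom (G (susp X)) (susp (G X)) := rt _ _ (psi (G X) ∘ fmap susp (co X)).
have thetaE A X (t : hom (susp (G X)) A) :
    tr _ _ (t ∘ theta X) = fmap F t ∘ (psi (G X) ∘ fmap susp (co X)).
  by rewrite tr_l (proj2 (trK _ _)).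
have theta_susp B X (t : hom (G X) B) :
    tr _ _ (fmap susp t ∘ theta X) = psi B ∘ fmap susp (tr _ _ t).
  by rewrite thetaE -coE fmap_comp !ccompA psi_nat.
have theta_epi X A (t : hom (susp (G X)) A) : t ∘ theta X = 0 -> t = 0.
  have [B [a [b [_ ab]]]] := susp_ess_surj A.
  have [t0 t0E] := susp_full (b ∘ t).
  move=> t_theta; have := theta_susp _ _ t0.
  rewrite -t0E -ccompA t_theta compm0 tr0 => e.
  suff: t0 = 0.
    move=> t00; rewrite -(ccomp1m t) -ab -ccompA t0E t00.
    by rewrite (additive_fmap0 _ _ (@susp_additive C)) compm0.
  apply: trI; rewrite tr0; apply: susp_faithful.
  rewrite (additive_fmap0 _ _ (@susp_additive D)).
  by rewrite -(ccomp1m (fmap _ _)) -phipsi -ccompA -e compm0.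
have theta_surj X A (s : hom (G (susp X)) A) : exists t, t ∘ theta X = s.
  have [B [a [b [_ ab]]]] := susp_ess_surj A.
  have [u uE] := susp_full (phi B ∘ tr _ _ (b ∘ s)).
  exists (a ∘ fmap susp (rt _ _ u)).
  rewrite -ccompA -[RHS]ccomp1m -ab -[RHS]ccompA; congr (_ ∘ _); apply: trI.
  by rewrite theta_susp (proj2 (trK _ _)) -uE ccompA psiphi ccomp1m.
have theta_nat X Y (x : hom X Y) :
    fmap susp (fmap G x) ∘ theta X = theta Y ∘ fmap G (fmap susp x).
  apply: trI; rewrite theta_susp tr_r /theta (proj2 (trK _ _)) -ccompA.
  by rewrite -fmap_comp -tr_r ccomp1m.
split=> [X X0|X|X Y Z x y z xyz].
- by apply: is_zero_id; apply: trI; rewrite (proj1 (X0 _) (tr _ _ 0)); apply: (proj1 (X0 _)).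
- exists (theta X); apply: is_iso_precomp => A t.
  + exact: theta_epi.
  + exact: theta_surj.
have [W [p [q xpq]]] := dist_cone (fmap G x).
have xpq1 := proj1 (dist_rot _ _ _) xpq; have xyz1 := proj1 (dist_rot _ _ _) xyz.
have [|c [cy cz]] := dist_mor (a := co X) (b := co Y) xyz (phi_dist _ _ _ _ _ _ xpq).
  by rewrite coE -tr_r ccomp1m.
have rcy : rt _ _ c ∘ fmap G y = p.
  by apply: trI; rewrite tr_r (proj2 (trK _ _)) cy -tr_l ccompm1.
have rcz : q ∘ rt _ _ c = theta X ∘ fmap G z.
  apply: trI; rewrite tr_l tr_r /theta !(proj2 (trK _ _)).
  by rewrite -ccompA cz !ccompA psiphi ccomp1m.
(* Exactness is an argument because it comes from [dist_extend_susp] in one half of the chase and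
   from [dist_extend] in the other. *)
have extend A X1 X2 X3 (x1 : hom X1 X2) (x2 : hom X2 X3) (t : hom (G X2) A) :
    (forall B (u : hom X2 B), u ∘ x1 = 0 -> exists r, u = r ∘ x2) ->
    t ∘ fmap G x1 = 0 -> exists r, t = r ∘ fmap G x2.
  move=> ex e; have [|r rE] := ex _ (tr _ _ t).
    by rewrite -tr_r e tr0.
  by exists (rt _ _ r); rewrite -rt_r -rE (proj1 (trK _ _)).
apply/(dist_iso3 xpq)/isomorphic_sym; exists (rt _ _ c).
apply: is_iso_precomp => A t.
  move=> tc; have [|s tE] := dist_extend xpq1 (t := t).
    by rewrite -rcy ccompA tc comp0m.
  have [|r rE] := extend _ _ _ _ _ _ (s ∘ theta X) (@dist_extend_susp _ _ _ _ _ _ _ xyz).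
    by rewrite -ccompA -rcz ccompA -tE.
  have [r' r'E] := theta_surj _ _ r.
  (* Naturality of [theta] allows cancelling it on the right. *)
  have sE : s = r' ∘ fmap susp (fmap G x).
    apply/eqP; rewrite -subr_eq0; apply/eqP/theta_epi.
    by rewrite ccompDl compNm -ccompA theta_nat ccompA r'E -rE subrr.
  by rewrite tE sE -ccompA (dist_comp0_susp xpq) compm0.
have [|s sE] := dist_extend xpq (t := t ∘ fmap G y).
  by apply: trI; rewrite !tr_r -ccompA (dist_comp0 xyz) compm0 tr0.
have [|r rE] := extend _ _ _ _ _ _ (t - s ∘ rt _ _ c) (@dist_extend _ _ _ _ _ _ _ xyz1).
  by rewrite ccompDl compNm -ccompA rcy sE subrr.
have [r' r'E] := theta_surj _ _ r.
exists (s + r' ∘ q).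
by rewrite ccompDl -(ccompA r') rcz ccompA r'E -rE addrC subrK.
Qed.

End Adjoints.

(** * Preimages of localizing subcategories *)

Lemma preserves_coproducts_comp (C D E : preadditive_cat) (G : functor D E)
    (F : functor C D) :
  preserves_coproducts G -> preserves_coproducts F ->
  preserves_coproducts (compF G F).
Proof. by move=> G_cop F_cop J X c inj /F_cop/G_cop. Qed.

(** Families are allowed because [projection_Loc] intersects preimages over all [w]; a single
    functor is a family over [unit]. *)
Lemma localizing_preimage (S T : ttcat_coprod) (K : Type)
    (F : K -> functor S T) (P : set T) :
  (forall k, cone_preserving (F k)) -> (forall k, preserves_coproducts (F k)) ->
  localizing_subcategory P -> localizing_subcategory [set X | forall k, P (F k X)].
Proof.
move=> F_cone F_cop [[P_iso P0 P_susp P_cone] P_cop]; split; first split.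
- by move=> X Y XY PX k; apply: P_iso (PX k); apply: fmap_isomorphic.
- by move=> X X0 k; apply: P0; apply: cp_zero.
- move=> X; split=> PX k; have FS := cp_susp (F_cone k) X.
  + by apply/P_susp; apply: P_iso (PX k).
  + by apply: P_iso (isomorphic_sym FS) _; apply/P_susp.
- move=> X Y Z u v w /= d PX PY k.
  have [v' [w' d']] := cp_cone (F_cone k) d.
  exact: P_cone d' (PX k) (PY k).
- by move=> J X c inj cop PX k; apply: P_cop (F_cop k _ _ _ _ cop) (fun j => PX j k).
Qed.

(** * Tensor-ideals and the ideal of zero objects *)

Section TensorIdeals.
Variable T : ttcat_coprod.
Implicit Types X Y Z : T.

Lemma tens_assoc X Y Z : isomorphic (X ⊗ Y ⊗ Z) (X ⊗ (Y ⊗ Z)).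
Proof. by exists (assoc (tt_mon T) X Y Z); apply: assoc_iso. Qed.

Lemma tens_unitr X : isomorphic (X ⊗ 𝟙_T) X.
Proof. by exists (runit (tt_mon T) X); apply: runit_iso. Qed.

Lemma zero_localizing_tensor_ideal :
  localizing_tensor_ideal [set X : T | is_zero X].
Proof.
have Sadd := @susp_additive T.
split; first split; first split => /=.
- by move=> X Y; apply: is_zero_iso.
- by [].
- by move=> X; split; [apply: is_zero_susp | apply: additive_is_zero].
- move=> X Y Z u v w d X0 Y0; apply: is_zero_id.
  (* Since [susp X] is zero, [idm Z] lifts through [v], hence factors through the zero object
     [Y]. *)
  have d' := proj1 (dist_rot _ _ _) d.
  have [|s ->] := dist_lift d' (t := idm Z).
    by rewrite ccompm1; apply: (proj2 (additive_is_zero Sadd X0 _)).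
  by rewrite (proj2 (Y0 _) s) compm0.
- move=> J X c inj cop X0; apply: is_zero_id.
  have [u [_ u_uniq]] := cop c inj.
  rewrite -(u_uniq (idm c)); last by move=> j; rewrite ccomp1m.
  by apply: u_uniq => j; rewrite comp0m (proj1 (X0 j c) (inj j)).
- move=> X Y X0; have [Tadd _] := tensr_exact Y.
  exact: additive_is_zero Tadd X0.
Qed.

End TensorIdeals.

(** * Images of localizing tensor-ideals under tt-functors *)

Section TTFunctors.
Variables (S T : ttcat_coprod) (f : functor S T).
Hypothesis f_tt : tt_functor f.

Lemma tt_functor_tens X Y : isomorphic (f X ⊗ f Y) (f (X ⊗ Y)).
Proof. by case: f_tt => _ [mu [eps [_ mu_iso _ _ _]]]; exists (mu X Y). Qed.

(** The preimage under [f] of a localizing tensor-ideal is again one, tensor closure coming from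
    strong monoidality. *)
Lemma tt_functor_Loc x y :
  preserves_coproducts f -> Loc⊗ [set y] x -> Loc⊗ [set f y] (f x).
Proof.
move=> f_cop xy M [[M_loc M_tens] My].
pose N := [set X | forall k : unit, M (f X)].
suff: N x by apply; exact: tt.
apply: xy; split; last by move=> _ -> _; apply: My.
split.
  apply: (localizing_preimage (F := fun _ : unit => f)) => // _.
  exact: triangulated_cone_preserving (proj1 f_tt).
move=> X Y NX k; have [[M_iso _ _ _] _] := M_loc.
apply: M_iso (tt_functor_tens X Y) _; apply: M_tens; exact: NX.
Qed.

End TTFunctors.

(** * Descent along the projection formula *)

Section Descent.
Variables (T : ttcat_coprod) (M : set T).
Hypothesis M_ideal : localizing_tensor_ideal M.

Lemma ideal_iso X Y : isomorphic X Y -> M X -> M Y.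
Proof. by case: M_ideal => [[[M_iso _ _ _] _] _]; apply: M_iso. Qed.

Lemma tens_Loc_unit (A : set T) x :
  Loc⊗ A 𝟙_T -> (forall a, A a -> M (x ⊗ a)) -> M x.
Proof.
move=> A1 xA; have [M_loc M_tens] := M_ideal.
apply: ideal_iso (tens_unitr x) _.
pose N := [set z | forall k : unit, M (x ⊗ z)].
suff: N 𝟙_T by apply; exact: tt.
apply: A1; split; last by move=> a Aa k; apply: xA.
split.
  apply: (localizing_preimage (F := fun _ : unit => tensl (tt_mon T) x)) => // _.
    exact/triangulated_cone_preserving/tensl_exact.
  exact: tensl_coprod.
move=> X Y NX k; apply: ideal_iso (tens_assoc x X Y) _.
by apply: M_tens; apply: NX.
Qed.

(** Splits the single generator, a coproduct, into its summands. *)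
Lemma tens_coprod (J : smallType) (z : J -> T) x :
  (forall j, M (x ⊗ z j)) -> M (x ⊗ coprod z).
Proof.
case: M_ideal => [[_ M_cop] _] Mz.
have cop := tensl_coprod (A := x) (@coprodP T J z).
exact: M_cop _ _ _ _ cop Mz.
Qed.

(** The projection formula serves twice: it turns the goal into [f x] lying in [N], and it puts
    [f y] in [N]. *)
Lemma projection_Loc (S : ttcat_coprod) (f : functor T S) (g : functor S T)
    (x y : T) :
  cone_preserving g -> preserves_coproducts g ->
  (forall x y, isomorphic (g (f x ⊗ y)) (x ⊗ g y)) ->
  M y -> Loc⊗ [set f y] (f x) -> M (x ⊗ g 𝟙_S).
Proof.
move=> g_cone g_cop pf My fxy; have [M_loc M_tens] := M_ideal.
apply: ideal_iso (pf _ _) _.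
(* Quantifying over w makes N stable under tensoring: z ⊗ X ⊗ w = z ⊗ (X ⊗ w). *)
pose N := [set z | forall w : S, M (g (z ⊗ w))].
suff: N (f x) by [].
apply: fxy; split; last first.
  by move=> _ -> w; apply: ideal_iso (isomorphic_sym (pf _ _)) _; apply: M_tens.
split.
  apply: (localizing_preimage (F := fun w => compF g (tensr (tt_mon S) w))) => // w.
    exact/cone_preserving_comp/triangulated_cone_preserving/tensr_exact.
  exact/preserves_coproducts_comp/tensr_coprod.
move=> X Y NX w.
exact: ideal_iso (fmap_isomorphic g (isomorphic_sym (tens_assoc X Y w))) (NX _).
Qed.

End Descent.

Theorem theorem1p1 (I : smallType) (T : ttcat_coprod) (Ti : I -> ttcat_coprod)
    (f : forall i : I, functor T (Ti i)) (g : forall i : I, functor (Ti i) T)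
    (f_tt : forall i : I, tt_functor (f i))
    (f_coprod : forall i : I, preserves_coproducts (f i))
    (g_adjoint : forall i : I, adjoint (g i) (f i) \/ adjoint (f i) (g i))
    (g_coprod : forall i : I, preserves_coproducts (g i))
    (projection_formula : forall (i : I) (x : T) (y : Ti i),
      isomorphic (g i (f i x ⊗ y)) (x ⊗ g i y))
    (unit_generated : Loc⊗ [set coprod (fun i : I => g i 𝟙_(Ti i))] 𝟙_T)
    (x y : T) :
  ((forall i : I, is_zero (f i x)) -> is_zero x) /\
  (Loc⊗ [set y] x <-> forall i : I, Loc⊗ [set f i y] (f i x)).
Proof.
have g_cone i : cone_preserving (g i).
  have [f_tri _] := f_tt i; case: (g_adjoint i).
    exact: left_adjoint_cone_preserving.
  exact: right_adjoint_cone_preserving.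
have building z : (forall i, Loc⊗ [set f i z] (f i x)) -> Loc⊗ [set z] x.
  move=> fxz M [M_ideal Mz].
  apply: (tens_Loc_unit M_ideal unit_generated) => _ ->.
  apply: tens_coprod => // i; apply: projection_Loc (fxz i) => //.
  exact: Mz.
split; last by split=> [xy i|]; [apply: tt_functor_Loc | apply: building].
(* Each [f i x], being zero, lies in every localizing tensor-ideal, so building puts [x] in the
   ideal generated by [O], which has only zero objects. *)
move=> fx0; have [O O0] := zero_exists T.
apply: (building O); last first.
  by split; [apply: zero_localizing_tensor_ideal | move=> _ ->].
by move=> i M [[[[_ M0 _ _] _] _] _]; apply: M0.
Qed.
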